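(* $\gamma^+(J_4) = \frac{4}{7}$, where $J_4$ is the $3$-graph on vertex set $\{1,2,3,4,5\}$ with edges $\{1ij : 2\leq i<j\leq 5\}$.
   Context: For a $3$-graph $H$, the minimum positive co-degree $\delta_2^+(H)$ is the largest $k$ such that every pair of vertices contained in some edge of $H$ is contained in at least $k$ edges (it is $0$ for the edgeless graph). For a $3$-graph $F$, $\mathrm{co^+ex}(n,F)$ is the maximum of $\delta_2^+(H)$ over $n$-vertex $3$-graphs $H$ not containing $F$ as a (not necessarily induced) subhypergraph, and $\gamma^+(F)=\lim_{n\to\infty}\mathrm{co^+ex}(n,F)/n$ (the limit exists). *)

(* Defs.v *)
From mathcomp Require Import all_boot all_order all_algebra.
From mathcomp Require Import all_classical all_reals all_analysis.

Set Implicit Arguments.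
Unset Strict Implicit.
Unset Printing Implicit Defensive.

Import Order.TTheory GRing.Theory Num.Theory.
Import numFieldNormedType.Exports.

Local Open Scope set_scope.
Local Open Scope nat_scope.

(* A 3-graph on the vertex set V is given by its set of edges. *)
Definition is_3graph (V : finType) (H : {set {set V}}) : bool :=
  [forall e : {set V}, (e \in H) ==> (#|e| == 3)].

Definition codegree (V : finType) (H : {set {set V}}) (P : {set V}) : nat :=
  #|[set e in H | P \subset e]|.

(* A codegree never exceeds #|H|, so the range of k does not restrict the
   maximum when H has an edge; when H is edgeless it leaves only k = 0. *)
Definition min_pos_codegree (V : finType) (H : {set {set V}}) : nat :=
  \max_(k < #|H|.+1 |
        [forall P : {set V},
           (#|P| == 2) && [exists e : {set V}, (e \in H) && (P \subset e)]
           ==> (k <= codegree H P)]) k.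

Definition contains (U V : finType) (F : {set {set U}}) (H : {set {set V}})
    : bool :=
  [exists f : {ffun U -> V},
     injectiveb f && [forall e : {set U}, (e \in F) ==> (f @: e \in H)]].

Definition coex (U : finType) (n : nat) (F : {set {set U}}) : nat :=
  \max_(H : {set {set 'I_n}} | is_3graph H && ~~ contains F H)
     min_pos_codegree H.

Definition coex_density (R : realType) (U : finType) (F : {set {set U}})
    (n : nat) : R :=
  ((coex n F)%:R / n%:R)%R.

Definition gamma_plus (R : realType) (U : finType) (F : {set {set U}}) : R :=
  limn (coex_density R F).

(* The vertices 1, ..., 5 are renumbered 0, ..., 4. *)
Definition J4 : {set {set 'I_5}} :=
  [set e : {set 'I_5} |
     [exists i : 'I_5, exists j : 'I_5,
        [&& 0 < i, i < j & e == [set ord0; i; j]]]].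

(* Main.v *)
Require Import Defs.
From mathcomp Require Import all_boot all_order all_algebra.
From mathcomp Require Import zify ring lra.

(* A 3-graph is J4-free iff the link of every vertex is K4-free.

   Lower bound: blow up the 28 non-collinear triples of the Fano plane. A pair
   in different parts sees 4 of the 7 parts, and the link of a vertex is a
   blow-up of K_6 minus a perfect matching, which is K4-free.

   Upper bound: let every positive codegree exceed 4n/7, and weight the pairs
   of a copy of some configuration C inside H. Averaging over all vertices u
   gives a u whose link contains pairs of more than 4/7 of the total weight. If
   every such link creates J4 or a configuration already excluded, then C is
   excluded too. A chain of 14 such exclusions starts near the complement of
   the Fano plane, passes through K_4^(3), and ends with a single edge. Copies
   need not be injective, because J4 covers all pairs of its vertices, so u
   may also be a vertex of the copy. *)

Local Open Scope set_scope.
Local Open Scope nat_scope.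

(** * Configurations and certificates of exclusion *)

(* The number [k] of vertices 0, ..., k-1, and the edges as increasing lists. *)
Definition config : Type := nat * seq (seq nat).

Definition pairs (k : nat) : seq (seq nat) :=
  [seq [:: i; j] | i <- iota 0 k, j <- iota i.+1 (k - i.+1)].

Definition triples (k : nat) : seq (seq nat) :=
  [seq rcons p c | p <- pairs k,
                   c <- iota (last 0 p).+1 (k - (last 0 p).+1)].

Definition all_but (k : nat) (miss : seq (seq nat)) : config :=
  (k, [seq e <- triples k | e \notin miss]).

Definition copy {V : finType} (H : {set {set V}}) (f : nat -> V)
    (es : seq (seq nat)) : bool :=
  all (fun e => [set x in map f e] \in H) es.

(** Sorting makes the image of an edge comparable with the increasing lists that encode the edges of
    a configuration. *)
Definition images (h : seq nat) (es : seq (seq nat)) : seq (seq nat) :=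
  [seq sort leq (map (nth 0 h) e) | e <- es].

(* With weights [ps], every set whose complement weighs at most [b] includes a
   member of [Fs]. The search branches on whether an element of a shortest
   member is kept or dropped; [n] is fuel. *)
Fixpoint covers (n : nat) (ps : seq (seq nat * nat)) (Fs : seq (seq (seq nat)))
    (b : nat) : bool :=
  if n isn't n'.+1 then false else
  if Fs isn't F0 :: _ then false else
  let F := foldr (fun F G => if size F < size G then F else G) F0 Fs in
  if F isn't p :: _ then [::] \in Fs else
  let w := sumn [seq q.2 | q <- ps & q.1 == p] in
  let ps' := [seq q <- ps | q.1 != p] in
  covers n' ps' [seq [seq q <- G | q != p] | G <- Fs] b
  && ((b < w) || covers n' ps' [seq G <- Fs | p \notin G] (b - w)).

Definition weighted_pairs (k : nat) (ws : seq nat) : seq (seq nat * nat) :=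
  [seq p <- zip (pairs k) ws | 0 < p.2].

(* A configuration C on k vertices, the weights of its pairs in lexicographic
   order, and, for earlier configurations D given by their index (J4 is
   number 0), maps from D to C extended by the new vertex k. *)
Definition certificate : Type :=
  config * seq nat * seq (nat * seq (seq nat)).

(* Each map turns into the set of edges through the new vertex that would
   complete a copy of D. *)
Definition demands (Ds : seq config) (C : config)
    (ms : seq (nat * seq (seq nat))) : seq (seq (seq nat)) :=
  [seq [seq e <- images h (nth C Ds m.1).2 | e \notin C.2] | m <- ms, h <- m.2].

(* A link has more than 4/7 of the weight W iff it misses at most
   (3 W - 1) / 7. *)
Definition refutes (Ds : seq config) (c : certificate) : bool :=
  let C := c.1.1 in
  let ps := weighted_pairs C.1 c.1.2 in
  let W := sumn (unzip2 ps) in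
  [&& all (fun e => (size e == 3) && all (gtn C.1) e) C.2,
      all (fun p => (size p.1 == 2) && has (subseq p.1) C.2) ps,
      all (fun m => m.1 < size Ds) c.2,
      0 < W &
      covers (size ps).+1 [seq (rcons p.1 C.1, p.2) | p <- ps]
        (demands Ds C c.2) ((3 * W).-1 %/ 7)].

Fixpoint refutes_all (Ds : seq config) (cs : seq certificate) : bool :=
  if cs is c :: cs' then refutes Ds c && refutes_all (rcons Ds c.1.1) cs'
  else true.

(** * Soundness of the search *)

(** The branching element [p] either satisfies [a], and can then be deleted from every member, or it
    fails [a]: then its weight [w] is paid from the budget [b] and the members containing [p] are
    given up. A weight above [b] rules out the second case. *)
Lemma covers_sound (a : pred (seq nat)) (n : nat) (ps : seq (seq nat * nat))
    (Fs : seq (seq (seq nat))) (b : nat) :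
  \sum_(q <- ps | ~~ a q.1) q.2 <= b -> covers n ps Fs b -> has (all a) Fs.
Proof.
elim: n ps Fs b => [//|n IHn] ps Fs b leb /=; case defFs: Fs => [//|F0 Fs0].
rewrite -defFs; case: (foldr _ _ _) => [|p F].
  by move=> Fsnil; apply/hasP; exists [::].
set w := sumn _; set ps' := [seq q <- ps | _].
have sum_ps' : \sum_(q <- ps' | ~~ a q.1) q.2 + (~~ a p) * w
    = \sum_(q <- ps | ~~ a q.1) q.2.
  rewrite [RHS](bigID (fun q => q.1 == p)) /= addnC big_filter_cond; congr (_ + _).
    rewrite /w sumnE big_map big_filter big_distrr /= big_mkcond /= [RHS]big_mkcond.
    apply: eq_bigr => q _; case: eqP => [->|_]; rewrite ?andbF //.
    by case: (a p); rewrite ?mul0n ?mul1n.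
  by apply: eq_bigl => q; rewrite andbC.
case/andP=> keep drop; case: (boolP (a p)) => [ap|nap].
  have /IHn/(_ keep) : \sum_(q <- ps' | ~~ a q.1) q.2 <= b.
    by move: leb; rewrite -sum_ps' ap mul0n addn0.
  case/hasP=> _ /mapP[G GFs ->] /allP aG; apply/hasP; exists G => //.
  apply/allP=> q qG; have [->//|qp] := eqVneq q p.
  by apply: aG; rewrite mem_filter qp.
move: leb; rewrite -sum_ps' nap mul1n => leb.
have wb : w <= b by apply: leq_trans leb; apply: leq_addl.
move: drop; rewrite ltnNge wb /= => /IHn drop.
have /drop : \sum_(q <- ps' | ~~ a q.1) q.2 <= b - w by rewrite leq_subRL // addnC.
by case/hasP=> G; rewrite mem_filter => /andP[_ GFs] aG; apply/hasP; exists G.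
Qed.

Arguments covers : simpl never.

(** * Averaging over the vertices *)

(** An edge through [P] is determined by its single vertex outside [P]. *)
Lemma codegree_card {V : finType} (H : {set {set V}}) (P : {set V}) :
  is_3graph H -> #|P| = 2 -> codegree H P <= #|[set u | u |: P \in H]|.
Proof.
move=> /forallP H3 P2.
apply: (leq_trans _ (leq_imset_card (fun u => u |: P) _)); apply/subset_leq_card.
apply/fintype.subsetP=> e; rewrite inE => /andP[eH Pe].
have /eqP e3 : #|e| == 3 by move: (H3 e); rewrite eH.
have /eqP/cards1P[u eu] : #|e :\: P| = 1 by rewrite cardsDS // e3 P2.
have eE : (e :\: P) :|: P = e by rewrite -{2}(setIidPr Pe) setUC setID.
by apply/imsetP; exists u; rewrite ?inE -eu eE.
Qed.

Definition large_codegrees {V : finType} (H : {set {set V}}) : Prop :=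
  forall P : {set V}, #|P| = 2 -> (exists2 e, e \in H & P \subset e) ->
  4 * #|V| < 7 * codegree H P.

(** Double counting of the missed weight: each pair is missed by fewer than 3/7 of the vertices, so
    some vertex misses less than 3/7 of the total weight. *)
Lemma heavy_vertex {V : finType} (H : {set {set V}}) (ps : seq (seq V * nat)) :
  is_3graph H -> large_codegrees H ->
  (forall q, q \in ps -> #|[set x in q.1]| = 2 /\
     exists2 e, e \in H & [set x in q.1] \subset e) ->
  0 < \sum_(q <- ps) q.2 ->
  exists u, 7 * \sum_(q <- ps | [set x in rcons q.1 u] \notin H) q.2
            < 3 * \sum_(q <- ps) q.2.
Proof.
move=> H3 Hd psP; have [W defW] : {W | W = \sum_(q <- ps) q.2} by eexists.
rewrite -defW => W0.
pose miss u q := if [set x in rcons q.1 u] \notin H then q.2 else 0.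
apply/existsP; rewrite -[[exists _, _]]negbK; apply/negP => /existsPn light.
have : #|V| * (3 * W) <= 7 * \sum_(q <- ps) \sum_(u : V) miss u q.
  rewrite exchange_big big_distrr -sum_nat_const /=; apply: leq_sum => u _.
  by rewrite -big_mkcond leqNgt.
(* By integrality the strict codegree bound leaves a slack of one per unit of weight; the total
   slack contradicts the previous inequality. *)
have le_q q : q \in ps ->
    7 * \sum_(u : V) miss u q + q.2 <= 3 * #|V| * q.2.
  move=> /psP[q2 qe]; have := Hd _ q2 qe.
  have := codegree_card H _ H3 q2; set U := [set u | _ |: _ \in H] => cU cV.
  have -> : \sum_(u : V) miss u q = #|~: U| * q.2.
    rewrite -big_mkcond sum_nat_const; congr (_ * _); apply: eq_card => u.
    have -> : (u \in ~: U) = (u |: [set x in q.1] \notin H).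
      by rewrite /U !inE.
    rewrite unfold_in /=; congr (~~ (_ \in H)); apply/setP => x.
    by rewrite !inE mem_rcons in_cons.
  have := cardsC U; move: cU cV; move: (codegree _ _) #|U| #|~: U| #|V| q.2.
  by move=> c a b n w; nia.
have : \sum_(q <- ps) (7 * \sum_(u : V) miss u q + q.2)
    <= \sum_(q <- ps) 3 * #|V| * q.2.
  by rewrite big_seq [leqRHS]big_seq; apply: leq_sum.
by rewrite big_split -!big_distrr /= -defW; move: W0; lia.
Qed.

(** A copy [f] of [C] extends to [g] by sending the new vertex to a heavy vertex [u]. The search
    then finds a demand met by the link of [u], and its map composed with [g] is a copy of an
    earlier configuration. *)
Lemma refutes_sound {V : finType} (H : {set {set V}}) (Ds : seq config)
    (c : certificate) :
  is_3graph H -> large_codegrees H ->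
  (forall D, D \in Ds -> forall g, ~~ copy H g D.2) ->
  refutes Ds c -> forall f, ~~ copy H f c.1.1.2.
Proof.
case: c => [[C ws] ms] H3 Hd freeDs; rewrite /refutes /=.
set ps := weighted_pairs _ _.
case/and5P=> /allP Cok /allP psok /allP msok W0 cov f; apply/negP => /allP fC.
pose fps := [seq (map f p.1, p.2) | p <- ps].
(* Although [f] may identify vertices, it is injective on each edge, so weighted pairs go to genuine
   pairs. *)
have e3 e : e \in C.2 -> uniq (map f e).
  move=> eC; have /andP[/eqP se _] := Cok _ eC.
  have /implyP/(_ (fC _ eC))/eqP := forallP H3 [set x in map f e].
  rewrite cardsE => ce; apply/card_uniqP; rewrite size_map se -ce.
  by apply: eq_card.
have fpsP q : q \in fps -> #|[set x in q.1]| = 2 /\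
    exists2 e, e \in H & [set x in q.1] \subset e.
  case/mapP=> p /psok/andP[/eqP p2 /hasP[e eC pe]] -> /=; split.
    rewrite cardsE; have /card_uniqP -> : uniq (map f p.1).
      by apply: subseq_uniq (e3 _ eC); apply: map_subseq.
    by rewrite size_map.
  exists [set x in map f e]; first exact: fC.
  by apply/subsetP=> x; rewrite !inE; apply: mem_subseq; apply: map_subseq.
have Wfps : \sum_(q <- fps) q.2 = sumn (unzip2 ps) by rewrite sumnE !big_map.
have [u] := heavy_vertex H fps H3 Hd fpsP ltac:(by rewrite Wfps).
rewrite Wfps => heavy; pose g i := if i == C.1 then u else f i.
have gf s : all (gtn C.1) s -> map g s = map f s.
  move=> /allP sC; apply/eq_in_map => i /sC /=.
  by rewrite /g; case: eqP => // ->; rewrite ltnn.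
pose a e := [set x in map g e] \in H.
have psC p : p \in ps -> all (gtn C.1) p.1.
  move=> /psok/andP[_ /hasP[e eC /mem_subseq pe]]; apply/allP=> i /pe.
  by have /andP[_ /allP] := Cok _ eC; apply.
have /covers_sound/(_ cov)/hasP[F] : \sum_(q <- [seq (rcons p.1 C.1, p.2) | p <- ps]
    | ~~ a q.1) q.2 <= (3 * sumn (unzip2 ps)).-1 %/ 7.
  rewrite leq_divRL // mulnC big_map.
  suff -> : \sum_(p <- ps | ~~ a (rcons p.1 C.1)) p.2
      = \sum_(q <- fps | [set x in rcons q.1 u] \notin H) q.2 by lia.
  rewrite big_map big_seq_cond [RHS]big_seq_cond; apply: eq_bigl => p.
  case pps: (p \in ps) => //=; rewrite /a map_rcons (gf _ (psC _ pps)).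
  by rewrite /g eqxx.
case/allpairsPdep=> [[i hs]] [h] [/msok /= ltiDs _ ->] /allP aF.
have /negP := freeDs _ (mem_nth C ltiDs) (g \o nth 0 h); apply.
apply/allP=> e eD; set e' := sort leq (map (nth 0 h) e).
have -> : [set x in map (g \o nth 0 h) e] = [set x in map g e'].
  rewrite map_comp; apply/setP => x; rewrite !inE.
  by apply: eq_mem_map => y; rewrite mem_sort.
(* An edge of the copy of [D] either lies in [C] already or belongs to the demand. *)
have [e'C|e'C] := boolP (e' \in C.2).
  by rewrite gf ?fC //; have /andP[] := Cok _ e'C.
by apply: (aF e'); rewrite mem_filter e'C; apply: map_f.
Qed.

Lemma refutes_all_sound {V : finType} (H : {set {set V}}) (Ds : seq config)
    (cs : seq certificate) :
  is_3graph H -> large_codegrees H ->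
  (forall D, D \in Ds -> forall g, ~~ copy H g D.2) -> refutes_all Ds cs ->
  forall c, c \in cs -> forall f, ~~ copy H f c.1.1.2.
Proof.
move=> H3 Hd; elim: cs Ds => [//|c cs IHcs] Ds freeDs /= /andP[rc rcs] c'.
have freec := refutes_sound _ _ _ H3 Hd freeDs rc.
rewrite in_cons => /predU1P[-> //|]; apply: IHcs rcs _ => D.
by rewrite mem_rcons in_cons => /predU1P[->|/freeDs].
Qed.

(** * The chain of exclusions and the upper bound *)

Definition J4_config : config :=
  all_but 5 [:: [:: 1; 2; 3]; [:: 1; 2; 4]; [:: 1; 3; 4]; [:: 2; 3; 4]].

(* The chain and its weights were found by a computer search with linear
   programming. Number 1 is the complement of the Fano plane minus one edge,
   number 2 the complement of the Fano plane minus one vertex, number 10 is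
   K_4^(3), number 13 is K_4^(3) minus one edge. *)
Definition refutation : seq certificate := [::
  (all_but 7 [:: [:: 0; 1; 2]; [:: 0; 1; 3]; [:: 0; 3; 4]; [:: 0; 5; 6];
      [:: 1; 3; 5]; [:: 1; 4; 6]; [:: 2; 3; 6]; [:: 2; 4; 5]],
   [:: 1; 4; 1; 4; 5; 4; 4; 1; 5; 4; 4; 5; 3; 3; 0; 4; 4; 4; 3; 0; 0],
   [:: (0, [:: [:: 0; 7; 1; 4; 5]; [:: 0; 7; 2; 3; 5]; [:: 0; 7; 2; 4; 5];
         [:: 0; 7; 2; 4; 6]; [:: 1; 7; 0; 4; 5]; [:: 1; 7; 2; 3; 4];
         [:: 1; 7; 2; 4; 5]; [:: 1; 7; 2; 5; 6]; [:: 2; 7; 0; 3; 4];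
         [:: 2; 7; 0; 3; 5]; [:: 2; 7; 1; 3; 4]; [:: 2; 7; 1; 3; 5];
         [:: 3; 7; 0; 2; 5]; [:: 3; 7; 1; 2; 4]; [:: 3; 7; 2; 4; 5];
         [:: 3; 7; 4; 5; 6]; [:: 4; 7; 0; 1; 2]; [:: 4; 7; 0; 1; 5];
         [:: 4; 7; 1; 2; 3]; [:: 4; 7; 1; 3; 5]; [:: 5; 7; 0; 1; 2];
         [:: 5; 7; 0; 1; 4]; [:: 5; 7; 0; 2; 3]; [:: 5; 7; 0; 3; 4];
         [:: 6; 7; 0; 1; 3]])]);
  (all_but 6 [:: [:: 0; 1; 2]; [:: 0; 3; 4]; [:: 1; 3; 5]; [:: 2; 4; 5]],
   [:: 1; 1; 1; 1; 2; 1; 1; 2; 1; 2; 1; 1; 1; 1; 1],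
   [:: (0, [:: [:: 0; 6; 1; 3; 5]; [:: 0; 6; 2; 3; 5]; [:: 0; 6; 2; 4; 5];
         [:: 1; 6; 0; 3; 4]; [:: 1; 6; 2; 4; 5]; [:: 2; 6; 0; 3; 4];
         [:: 2; 6; 0; 3; 5]; [:: 2; 6; 1; 3; 4]; [:: 2; 6; 1; 3; 5];
         [:: 3; 6; 0; 1; 2]; [:: 3; 6; 0; 2; 5]; [:: 3; 6; 1; 2; 4];
         [:: 3; 6; 2; 4; 5]; [:: 4; 6; 0; 1; 2]; [:: 4; 6; 1; 3; 5];
         [:: 5; 6; 0; 1; 2]; [:: 5; 6; 0; 2; 3]; [:: 5; 6; 0; 3; 4]]);
       (1, [:: [:: 6; 0; 5; 1; 4; 2; 3]; [:: 6; 0; 5; 2; 3; 1; 4];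
         [:: 6; 0; 5; 3; 2; 4; 1]; [:: 6; 0; 5; 4; 1; 3; 2];
         [:: 6; 1; 4; 2; 3; 0; 5]; [:: 6; 1; 4; 3; 2; 5; 0];
         [:: 6; 1; 4; 5; 0; 3; 2]; [:: 6; 2; 3; 4; 1; 5; 0];
         [:: 6; 2; 3; 5; 0; 4; 1]; [:: 6; 3; 2; 4; 1; 0; 5];
         [:: 6; 3; 2; 5; 0; 1; 4]; [:: 6; 4; 1; 5; 0; 2; 3]])]);
  (all_but 7 [:: [:: 0; 1; 2]; [:: 0; 1; 3]; [:: 0; 1; 6]; [:: 0; 3; 4];
      [:: 0; 3; 6]; [:: 0; 5; 6]; [:: 1; 3; 5]; [:: 1; 3; 6]; [:: 1; 4; 6];
      [:: 2; 3; 6]; [:: 2; 4; 5]],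
   [:: 1; 3; 1; 3; 3; 1; 3; 1; 3; 3; 1; 3; 3; 3; 3; 3; 3; 1; 3; 3; 3],
   [:: (0, [:: [:: 0; 7; 1; 4; 5]; [:: 0; 7; 2; 3; 5]; [:: 0; 7; 2; 4; 5];
         [:: 0; 7; 2; 4; 6]; [:: 1; 7; 0; 4; 5]; [:: 1; 7; 2; 3; 4];
         [:: 1; 7; 2; 4; 5]; [:: 2; 7; 0; 3; 4]; [:: 2; 7; 0; 5; 6];
         [:: 2; 7; 1; 3; 5]; [:: 2; 7; 1; 4; 6]; [:: 3; 7; 0; 2; 5];
         [:: 3; 7; 1; 2; 4]; [:: 3; 7; 2; 4; 5]; [:: 3; 7; 4; 5; 6];
         [:: 4; 7; 0; 1; 2]; [:: 4; 7; 0; 2; 6]; [:: 4; 7; 0; 5; 6];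
         [:: 4; 7; 1; 3; 5]; [:: 4; 7; 2; 3; 6]; [:: 5; 7; 0; 1; 2];
         [:: 5; 7; 0; 1; 4]; [:: 5; 7; 0; 3; 4]; [:: 5; 7; 1; 4; 6];
         [:: 5; 7; 2; 3; 6]; [:: 6; 7; 0; 2; 4]; [:: 6; 7; 1; 2; 5];
         [:: 6; 7; 2; 4; 5]; [:: 6; 7; 3; 4; 5]; [:: 7; 0; 1; 3; 6]]);
       (2, [:: [:: 7; 0; 2; 3; 5; 4]; [:: 7; 0; 4; 6; 2; 5]; [:: 7; 0; 5; 1; 4; 2];
         [:: 7; 0; 5; 3; 2; 4]; [:: 7; 1; 2; 3; 4; 5]])]);
  (all_but 7 [:: [:: 0; 1; 2]; [:: 0; 1; 3]; [:: 0; 3; 4]; [:: 0; 5; 6];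
      [:: 1; 3; 5]; [:: 1; 3; 6]; [:: 1; 4; 6]; [:: 2; 3; 6]; [:: 2; 4; 5];
      [:: 4; 5; 6]],
   [:: 0; 1; 0; 1; 1; 1; 1; 0; 1; 1; 1; 1; 1; 1; 1; 1; 1; 0; 0; 0; 0],
   [:: (0, [:: [:: 0; 7; 2; 4; 5]; [:: 0; 7; 2; 4; 6]; [:: 1; 7; 2; 4; 5];
         [:: 1; 7; 2; 5; 6]; [:: 2; 7; 0; 3; 4]; [:: 2; 7; 0; 5; 6];
         [:: 2; 7; 1; 3; 5]; [:: 2; 7; 1; 4; 6]; [:: 3; 7; 2; 4; 5];
         [:: 4; 7; 0; 1; 2]; [:: 4; 7; 1; 2; 3]; [:: 5; 7; 0; 1; 2];
         [:: 5; 7; 0; 2; 3]; [:: 6; 7; 0; 1; 2]])]);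
  (all_but 7 [:: [:: 0; 1; 2]; [:: 0; 1; 3]; [:: 0; 1; 6]; [:: 0; 3; 4];
      [:: 0; 5; 6]; [:: 1; 3; 5]; [:: 1; 4; 6]; [:: 2; 3; 6]; [:: 2; 4; 5];
      [:: 4; 5; 6]],
   [:: 0; 2; 1; 2; 2; 1; 2; 1; 2; 2; 1; 2; 2; 2; 1; 2; 2; 2; 1; 1; 1],
   [:: (0, [:: [:: 0; 7; 2; 3; 6]; [:: 0; 7; 2; 4; 5]; [:: 0; 7; 2; 4; 6];
         [:: 1; 7; 2; 3; 4]; [:: 1; 7; 2; 4; 5]; [:: 1; 7; 2; 5; 6];
         [:: 2; 7; 0; 3; 4]; [:: 2; 7; 0; 3; 5]; [:: 2; 7; 0; 5; 6];
         [:: 2; 7; 1; 3; 4]; [:: 2; 7; 1; 3; 5]; [:: 2; 7; 1; 4; 6];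
         [:: 3; 7; 0; 2; 5]; [:: 3; 7; 0; 5; 6]; [:: 3; 7; 1; 2; 4];
         [:: 3; 7; 1; 4; 6]; [:: 3; 7; 4; 5; 6]; [:: 4; 7; 0; 1; 2];
         [:: 4; 7; 0; 1; 5]; [:: 4; 7; 0; 2; 6]; [:: 4; 7; 1; 2; 3];
         [:: 4; 7; 1; 3; 5]; [:: 5; 7; 0; 1; 2]; [:: 5; 7; 0; 1; 4];
         [:: 5; 7; 0; 2; 3]; [:: 5; 7; 1; 2; 6]; [:: 6; 7; 0; 2; 4];
         [:: 6; 7; 0; 3; 4]; [:: 6; 7; 1; 3; 5]]);
       (2, [:: [:: 7; 0; 2; 4; 6; 3]; [:: 7; 0; 5; 3; 2; 4]; [:: 7; 0; 6; 4; 2; 3];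
         [:: 7; 1; 2; 5; 6; 3]; [:: 7; 1; 6; 5; 2; 3]])]);
  (all_but 6 [:: [:: 0; 1; 2]; [:: 0; 1; 3]; [:: 0; 3; 4]; [:: 1; 3; 5];
      [:: 2; 4; 5]],
   [:: 3; 9; 3; 9; 14; 9; 3; 14; 9; 14; 7; 7; 9; 9; 7],
   [:: (0, [:: [:: 0; 6; 1; 4; 5]; [:: 0; 6; 2; 3; 5]; [:: 0; 6; 2; 4; 5];
         [:: 1; 6; 0; 4; 5]; [:: 1; 6; 2; 3; 4]; [:: 1; 6; 2; 4; 5];
         [:: 2; 6; 0; 3; 4]; [:: 2; 6; 0; 3; 5]; [:: 2; 6; 1; 3; 4];
         [:: 2; 6; 1; 3; 5]; [:: 3; 6; 0; 2; 5]; [:: 3; 6; 1; 2; 4];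
         [:: 3; 6; 2; 4; 5]; [:: 4; 6; 0; 1; 2]; [:: 4; 6; 0; 1; 5];
         [:: 4; 6; 1; 2; 3]; [:: 4; 6; 1; 3; 5]; [:: 5; 6; 0; 1; 2];
         [:: 5; 6; 0; 1; 4]; [:: 5; 6; 0; 2; 3]; [:: 5; 6; 0; 3; 4]]);
       (2, [:: [:: 6; 0; 5; 3; 2; 4]]);
       (3, [:: [:: 6; 0; 5; 1; 4; 2; 3]]);
       (4, [:: [:: 0; 1; 2; 3; 4; 5; 6]; [:: 0; 3; 4; 1; 2; 5; 6];
         [:: 1; 0; 2; 3; 5; 4; 6]; [:: 1; 3; 5; 0; 2; 4; 6];
         [:: 2; 4; 5; 6; 3; 1; 0]; [:: 3; 0; 4; 1; 5; 2; 6];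
         [:: 3; 1; 5; 0; 4; 2; 6]; [:: 4; 2; 5; 6; 1; 3; 0];
         [:: 4; 5; 2; 6; 1; 0; 3]; [:: 5; 4; 2; 6; 0; 1; 3]]);
       (5, [:: [:: 0; 1; 2; 3; 4; 5; 6]; [:: 0; 3; 4; 1; 2; 5; 6];
         [:: 1; 3; 5; 0; 2; 4; 6]])]);
  (all_but 7 [:: [:: 0; 1; 2]; [:: 0; 1; 5]; [:: 0; 1; 6]; [:: 0; 2; 6];
      [:: 0; 3; 4]; [:: 1; 2; 6]; [:: 1; 3; 5]; [:: 1; 3; 6]; [:: 1; 5; 6];
      [:: 2; 4; 5]; [:: 2; 4; 6]; [:: 3; 5; 6]; [:: 4; 5; 6]],
   [:: 0; 3; 2; 3; 4; 1; 1; 1; 4; 0; 0; 6; 3; 1; 0; 4; 4; 1; 3; 1; 0],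
   [:: (0, [:: [:: 0; 7; 2; 3; 5]; [:: 0; 7; 2; 4; 5]; [:: 0; 7; 3; 5; 6];
         [:: 0; 7; 4; 5; 6]; [:: 1; 7; 2; 3; 4]; [:: 2; 7; 0; 3; 4];
         [:: 2; 7; 1; 3; 4]; [:: 2; 7; 1; 3; 5]; [:: 3; 7; 0; 1; 2];
         [:: 3; 7; 0; 2; 5]; [:: 3; 7; 0; 2; 6]; [:: 3; 7; 1; 2; 4];
         [:: 3; 7; 2; 4; 5]; [:: 3; 7; 2; 4; 6]; [:: 4; 7; 0; 1; 2];
         [:: 4; 7; 0; 1; 5]; [:: 4; 7; 0; 1; 6]; [:: 4; 7; 1; 2; 3];
         [:: 4; 7; 1; 3; 5]; [:: 5; 7; 0; 2; 3]; [:: 5; 7; 0; 3; 4];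
         [:: 6; 7; 0; 3; 4]]);
       (6, [:: [:: 7; 0; 2; 3; 5; 4]; [:: 7; 0; 5; 3; 2; 4]; [:: 7; 2; 0; 5; 3; 4];
         [:: 7; 2; 3; 5; 0; 4]])]);
  (all_but 6 [:: [:: 0; 1; 2]; [:: 0; 1; 5]; [:: 0; 3; 4]; [:: 1; 3; 5];
      [:: 2; 4; 5]],
   [:: 0; 5; 2; 4; 5; 1; 1; 5; 0; 7; 4; 2; 4; 5; 4],
   [:: (0, [:: [:: 0; 6; 2; 3; 5]; [:: 0; 6; 2; 4; 5]; [:: 1; 6; 2; 3; 4];
         [:: 2; 6; 0; 3; 4]; [:: 2; 6; 0; 3; 5]; [:: 2; 6; 1; 3; 4];
         [:: 2; 6; 1; 3; 5]; [:: 3; 6; 0; 1; 2]; [:: 3; 6; 0; 2; 5];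
         [:: 3; 6; 1; 2; 4]; [:: 3; 6; 2; 4; 5]; [:: 4; 6; 0; 1; 2];
         [:: 4; 6; 0; 1; 5]; [:: 4; 6; 1; 2; 3]; [:: 4; 6; 1; 3; 5];
         [:: 5; 6; 0; 2; 3]; [:: 5; 6; 0; 3; 4]]);
       (6, [:: [:: 6; 0; 2; 3; 5; 4]; [:: 6; 0; 5; 3; 2; 4]; [:: 6; 2; 0; 5; 3; 4];
         [:: 6; 2; 3; 5; 0; 4]]);
       (7, [:: [:: 0; 1; 2; 3; 4; 5; 6]; [:: 5; 1; 3; 2; 4; 0; 6]])]);
  (all_but 5 [:: [:: 0; 1; 2]; [:: 0; 3; 4]],
   [:: 1; 1; 1; 1; 1; 2; 2; 2; 2; 1],
   [:: (0, [:: [:: 1; 5; 0; 3; 4]; [:: 1; 5; 2; 3; 4]; [:: 2; 5; 0; 3; 4];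
         [:: 2; 5; 1; 3; 4]; [:: 3; 5; 0; 1; 2]; [:: 3; 5; 1; 2; 4];
         [:: 4; 5; 0; 1; 2]; [:: 4; 5; 1; 2; 3]]);
       (6, [:: [:: 5; 1; 3; 2; 4; 0]; [:: 5; 1; 4; 2; 3; 0]; [:: 5; 3; 1; 4; 2; 0];
         [:: 5; 3; 2; 4; 1; 0]]);
       (8, [:: [:: 5; 1; 3; 2; 4; 0]; [:: 5; 1; 4; 2; 3; 0]; [:: 5; 2; 3; 1; 4; 0];
         [:: 5; 2; 4; 1; 3; 0]; [:: 5; 3; 1; 4; 2; 0]; [:: 5; 3; 2; 4; 1; 0];
         [:: 5; 4; 1; 3; 2; 0]; [:: 5; 4; 2; 3; 1; 0]])]);
  (all_but 4 [::],
   [:: 1; 1; 1; 1; 1; 1],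
   [:: (0, [:: [:: 0; 4; 1; 2; 3]; [:: 1; 4; 0; 2; 3]; [:: 2; 4; 0; 1; 3];
         [:: 3; 4; 0; 1; 2]]);
       (9, [:: [:: 4; 0; 1; 2; 3]; [:: 4; 0; 2; 1; 3]; [:: 4; 0; 3; 1; 2]])]);
  (all_but 6 [:: [:: 0; 1; 5]; [:: 0; 2; 4]; [:: 1; 2; 3]; [:: 1; 3; 4];
      [:: 1; 3; 5]; [:: 2; 3; 4]; [:: 2; 3; 5]; [:: 2; 4; 5]; [:: 3; 4; 5]],
   [:: 2; 1; 1; 1; 1; 2; 0; 2; 1; 0; 0; 1; 0; 1; 1],
   [:: (0, [:: [:: 0; 6; 1; 2; 3]; [:: 0; 6; 1; 3; 4]; [:: 1; 6; 0; 2; 4];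
         [:: 1; 6; 2; 4; 5]; [:: 2; 6; 0; 1; 5]; [:: 4; 6; 0; 1; 5]]);
       (10, [:: [:: 6; 0; 1; 2]; [:: 6; 0; 1; 4]; [:: 6; 0; 2; 5]; [:: 6; 0; 3; 5];
         [:: 6; 0; 4; 5]; [:: 6; 1; 2; 5]; [:: 6; 1; 4; 5]])]);
  (all_but 5 [:: [:: 0; 2; 4]; [:: 1; 2; 3]; [:: 1; 3; 4]; [:: 2; 3; 4]],
   [:: 2; 1; 1; 1; 1; 0; 1; 0; 0; 0],
   [:: (0, [:: [:: 0; 5; 1; 2; 3]; [:: 0; 5; 1; 3; 4]; [:: 1; 5; 0; 2; 4]]);
       (10, [:: [:: 5; 0; 1; 2]; [:: 5; 0; 1; 4]]);
       (11, [:: [:: 0; 1; 2; 3; 4; 5]])]);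
  (all_but 4 [:: [:: 1; 2; 3]],
   [:: 1; 1; 1; 1; 1; 1],
   [:: (12, [:: [:: 0; 1; 4; 3; 2]; [:: 0; 2; 4; 1; 3]; [:: 0; 3; 4; 2; 1];
         [:: 1; 0; 2; 4; 3]; [:: 2; 0; 1; 4; 3]; [:: 3; 0; 1; 4; 2]])]);
  (all_but 3 [::],
   [:: 1; 1; 1],
   [:: (13, [:: [:: 0; 3; 1; 2]; [:: 1; 3; 0; 2]; [:: 2; 3; 0; 1]])])].

Lemma refutation_ok : refutes_all [:: J4_config] refutation.
Proof. by vm_compute. Qed.

(** Any two vertices of J4 lie in a common edge, whose image has three elements; hence [f] separates
    all five vertices and gives an embedding. *)
Lemma J4_freeP {V : finType} (H : {set {set V}}) (f : nat -> V) :
  is_3graph H -> ~~ contains J4 H -> ~~ copy H f J4_config.2.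
Proof.
move=> /forallP H3; apply: contraNN => /allP fH.
have /allP pairP : all (fun p => has (subseq p) J4_config.2) (pairs 5) by [].
have f_neq (i j : nat) : i < j < 5 -> f i != f j.
  case/andP=> ij j5.
  have : [:: i; j] \in pairs 5.
    by apply/allpairsPdep; exists i, j; rewrite !mem_iota; split=> //; lia.
  case/pairP/hasP=> e eJ ije.
  have /allP/(_ _ eJ)/eqP se : all (fun e => size e == 3) J4_config.2 by [].
  have /implyP/(_ (fH _ eJ)) := H3 [set x in map f e].
  rewrite cardsE -se -(size_map f) => /eqP/card_uniqP ue.
  have := subseq_uniq (map_subseq f ije) ue.
  by rewrite /= inE andbT.
apply/existsP; exists [ffun i : 'I_5 => f i]; apply/andP; split.
  apply/injectiveP => i j; rewrite !ffunE => fij; apply/eqP/negPn/negP => ij.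
  have {ij} : (i < j < 5) || (j < i < 5).
    by move: ij; rewrite !ltn_ord !andbT -neq_ltn; apply.
  by case/orP=> /f_neq; rewrite fij eqxx.
apply/forall_inP=> e; rewrite inE => /existsP[i] /existsP[j] /and3P[i0 ij /eqP->].
have -> : [ffun i : 'I_5 => f i] @: [set ord0; i; j]
    = [set x in map f [:: 0; nat_of_ord i; nat_of_ord j]].
  by rewrite !imsetU !imset_set1 !ffunE; apply/setP => x; rewrite !inE orbA.
apply: fH; have := ltn_ord j; move: i0 ij.
case: i j => [i _] [j _] /=.
by do 5?[case: i => [|i] //]; do 5?[case: j => [|j] //].
Qed.

Lemma coex_J4_le (n : nat) : 7 * coex n J4 <= 4 * n.
Proof.
rewrite mulnC -leq_divRL //; apply/bigmax_leqP => H /andP[H3 J4free].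
apply/bigmax_leqP => k /forallP codeg_k; rewrite leq_divRL // leqNgt.
apply/negP => lt_k; have /forallP card3 := H3.
(* Without edges, [k] ranges over 0 only, against [lt_k]. *)
have : H != set0.
  apply: contraTneq lt_k => H0; case: k {codeg_k} => k /=.
  by rewrite H0 cards0; lia.
case/set0Pn=> e eH; have /implyP/(_ eH)/eqP e3 := card3 e.
have /card_gt0P[x0 _] : 0 < #|e| by rewrite e3.
have Hcodeg : large_codegrees H.
  move=> P P2 [d dH Pd]; rewrite card_ord; apply: (leq_trans lt_k).
  rewrite mulnC leq_pmul2l //; have := codeg_k P; rewrite P2 eqxx /=.
  by move=> /implyP; apply; apply/existsP; exists d; rewrite dH.
have freeJ4 D : D \in [:: J4_config] -> forall g, ~~ copy H g D.2.
  by rewrite inE => /eqP-> g; apply: J4_freeP.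
have := refutes_all_sound H _ _ H3 Hcodeg freeJ4 refutation_ok.
(* J4 being number 0, the single edge is number 14 of the chain and entry 13 of the list; any edge
   [e] of [H] is a copy of it. *)
have [c cr c012] : exists2 c, c \in refutation & c.1.1.2 = [:: [:: 0; 1; 2]].
  by exists (nth (J4_config, [::], [::]) refutation 13) => //; apply: mem_nth.
move/(_ c cr (nth x0 (enum e))); rewrite c012 /copy /= andbT => /negP; apply.
suff -> : [set x in [:: nth x0 (enum e) 0; nth x0 (enum e) 1; nth x0 (enum e) 2]] = e.
  by [].
rewrite -[RHS]set_enum.
by move: e3; rewrite cardE; case: (enum e) => [|a [|b [|d []]]].
Qed.

(** * The lower bound from the Fano plane *)

(* {0, 1, 3} is a perfect difference set modulo 7. *)
Definition fano_lines : seq (seq nat) :=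
  [seq [:: t; (t + 1) %% 7; (t + 3) %% 7] | t <- iota 0 7].

Definition nonline (s : seq nat) : bool :=
  uniq s && ~~ has (fun l => all (mem l) s) fano_lines.

Definition blowup (n : nat) : {set {set 'I_n}} :=
  [set e : {set 'I_n} | (#|e| == 3) &&
    nonline [seq i %% 7 | i : 'I_n <- enum e]].

Lemma nonline_perm (s t : seq nat) : perm_eq s t -> nonline s = nonline t.
Proof.
move=> st; rewrite /nonline (perm_uniq st); congr (_ && ~~ _).
by apply: eq_has => l; apply: perm_all.
Qed.

(** Frees membership from the order of [enum]. If [s] repeats a vertex, it repeats a residue too,
    and both sides are false. *)
Lemma mem_blowup (n : nat) (s : seq 'I_n) : size s = 3 ->
  ([set x in s] \in blowup n) = nonline [seq i %% 7 | i : 'I_n <- s].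
Proof.
move=> s3; rewrite inE.
have -> : (#|[set x in s]| == 3) = uniq s.
  by rewrite cardsE -[X in _ == X]s3; apply/eqP/card_uniqP.
have [us|nus] := boolP (uniq s) => /=.
  apply/nonline_perm/perm_map/uniq_perm => [||x]; rewrite ?enum_uniq //.
  by rewrite mem_enum inE.
by rewrite /nonline; case: uniq (@map_uniq _ _ (fun i : 'I_n => i %% 7) s) nus => // ->.
Qed.

Lemma blowup_3graph (n : nat) : is_3graph (blowup n).
Proof. by apply/forallP => e; apply/implyP; rewrite inE => /andP[]. Qed.

(* The nested tests prune the search over all 5-tuples. *)
Definition nonline_K4_link : bool :=
  has (fun a => has (fun b => has (fun c => if nonline [:: a; b; c] then
    has (fun d => if nonline [:: a; b; d] then if nonline [:: a; c; d] then
      has (fun e => all (fun x => nonline [:: a; x; e]) [:: b; c; d]) (iota 0 7)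
      else false else false) (iota 0 7)
    else false) (iota 0 7)) (iota 0 7)) (iota 0 7).

(** Being an edge depends on residues only, so a copy of J4 would give five residues of the kind
    excluded by a finite check. *)
Lemma blowup_J4_free (n : nat) : ~~ contains J4 (blowup n).
Proof.
apply/existsP => -[f /andP[_ /forall_inP fJ]].
pose c (i : nat) := nat_of_ord (f (inord i)) %% 7.
have c7 i : c i \in iota 0 7 by rewrite mem_iota ltn_mod.
have link (i j : nat) : 0 < i -> i < j -> j < 5 -> nonline [:: c 0; c i; c j].
  move=> i0 ij j5; have i5 := ltn_trans ij j5.
  have /fJ : [set ord0; inord i; inord j] \in J4.
    rewrite inE; apply/existsP; exists (inord i); apply/existsP; exists (inord j).
    by rewrite !inordK // i0 ij eqxx.
  suff -> : f @: [set ord0; inord i; inord j]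
      = [set x in [:: f (inord 0); f (inord i); f (inord j)]] by rewrite mem_blowup.
  have -> : ord0 = inord 0 :> 'I_5 by apply: val_inj; rewrite /= inordK.
  by rewrite !imsetU !imset_set1; apply/setP => x; rewrite !inE orbA.
have : nonline_K4_link = false by vm_compute.
move/negP; apply.
apply/hasP; exists (c 0) => //; apply/hasP; exists (c 1) => //.
apply/hasP; exists (c 2) => //; rewrite link //.
apply/hasP; exists (c 3) => //; rewrite !link //.
by apply/hasP; exists (c 4) => //; rewrite /= !link.
Qed.

(** The numbers below [7 * m] form [m] full periods. *)
Lemma count_residues (Q : pred nat) (m n : nat) : 7 * m <= n ->
  count Q (iota 0 7) * m <= #|[set u : 'I_n | Q (u %% 7)]|.
Proof.
move=> mn; rewrite -sum1_card; under eq_bigl do rewrite inE.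
rewrite -(big_mkord (fun i => Q (i %% 7)) (fun=> 1)).
rewrite (big_cat_nat (n := 7 * m)) //; apply: leq_trans (leq_addr _ _).
elim: m {mn} => [|m IHm]; first by rewrite muln0.
rewrite mulnSr (big_cat_nat (n := 7 * m)) //; last by lia.
apply: leq_add IHm _; rewrite -{1}[7 * m]add0n big_addn.
have -> : 7 * m.+1 - 7 * m = 7 by lia.
rewrite -sum1_count [leqLHS]big_mkcond [leqRHS]big_mkcond.
rewrite [leqLHS]big_seq [leqRHS]big_seq.
apply: leq_sum => i; rewrite mem_iota => /= i7.
by rewrite mulnC addnC modnMDl modn_small.
Qed.

(** The line through two points takes 3 of the 7 points. *)
Lemma nonline_codegree (a b : nat) : a < 7 -> b < 7 -> a != b ->
  count (fun r => nonline [:: r; a; b]) (iota 0 7) = 4.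
Proof.
move=> a7 b7 ab; have /allP/(_ a) : all (fun a => all (fun b => (a != b) ==>
  (count (fun r => nonline [:: r; a; b]) (iota 0 7) == 4)) (iota 0 7)) (iota 0 7).
  by vm_compute.
rewrite mem_iota => /(_ a7)/allP/(_ b); rewrite mem_iota => /(_ b7).
by rewrite ab => /eqP.
Qed.

Lemma blowup_codegree (n : nat) (x y : 'I_n) : x %% 7 != y %% 7 ->
  4 * (n %/ 7) <= codegree (blowup n) [set x; y].
Proof.
move=> xy; rewrite -[X in X * _](nonline_codegree (x %% 7) (y %% 7)) ?ltn_mod //.
apply: leq_trans (count_residues _ (n %/ 7) n _) _.
  by rewrite mulnC leq_trunc_div.
set U := [set u : 'I_n | _].
(* The residues of an edge are distinct, so [U] avoids [x] and [y]; this makes adding [u] to the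
   pair injective on [U]. *)
have Uxy u : u \in U -> u \notin [set x; y].
  rewrite !inE; apply: contraTN => uxy; rewrite /nonline /= !inE.
  by case/orP: uxy => /eqP->; rewrite eqxx ?orbT.
rewrite -(card_in_imset (f := fun u => u |: [set x; y])); last first.
  move=> u v /Uxy uU /Uxy vU uv.
  have : u \in v |: [set x; y] by rewrite -uv setU11.
  by rewrite !inE -in_set2 (negPf uU) orbF => /eqP.
apply/subset_leq_card/subsetP => _ /imsetP[u uU ->]; rewrite inE subsetUr andbT.
have -> : u |: [set x; y] = [set z in [:: u; x; y]] by apply/setP=> z; rewrite !inE.
by rewrite mem_blowup //=; move: uU; rewrite inE.
Qed.

Lemma coex_J4_ge (n : nat) : 4 * (n %/ 7) <= coex n J4.
Proof.
have [n0|n0] := posnP (n %/ 7); first by rewrite n0.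
have n7 : 7 <= n by rewrite leqNgt; apply/negP => /divn_small; lia.
apply: leq_trans (leq_bigmax_cond (blowup n) _); last first.
  by rewrite blowup_3graph blowup_J4_free.
(* The maximum only ranges up to the number of edges, which is at least the codegree of the vertices
   0 and 1. *)
have kH : 4 * (n %/ 7) < #|blowup n|.+1.
  have n1 : 1 < n by lia.
  apply: leq_trans (blowup_codegree n (Ordinal (ltnW n1)) (Ordinal n1) _) _ => //.
  by apply/subset_leq_card/subsetP => e; rewrite inE => /andP[].
apply: (bigmax_sup (Ordinal kH)) => //=; apply/forallP => P; apply/implyP.
case/andP=> /cards2P[x [y [xy ->]]] /existsP[e /andP[eH xye]].
apply: blowup_codegree; move: eH; rewrite inE => /andP[_ /andP[/= ue _]].
apply: contra xy => /eqP xy7; apply/eqP.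
have /dinjectiveP inj7 : dinjectiveb (fun i : 'I_n => i %% 7) e by [].
by apply: inj7 => //; apply: (subsetP xye); rewrite !inE eqxx ?orbT.
Qed.

(* The limit *)
From mathcomp Require Import all_classical all_reals all_analysis.

Import Order.TTheory GRing.Theory Num.Theory.
Import numFieldNormedType.Exports.

Local Open Scope ring_scope.

Theorem theorem2p4 (R : realType) :
  cvgn (coex_density R J4) /\ gamma_plus R J4 = 4%:R / 7%:R.
Proof.
suff lim_density : (coex_density R J4 @ \oo --> (4%:R / 7%:R : R))%classic.
  by split; [apply/cvg_ex; exists (4%:R / 7%:R) | apply: cvg_lim].
(* Rounding costs at most 24/(7n), which is below 8/(n+1) for positive n; [harmonic n] is
   1/(n+1). *)
have lower_cvg : ((fun n => 4%:R / 7%:R - 8%:R * harmonic n) @ \oo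
    --> (4%:R / 7%:R : R))%classic.
  rewrite -[X in (_ --> X)%classic]subr0 -[X in _ - X](mulr0 8%:R).
  by apply: cvgB; [apply: cvg_cst | apply: cvgMr; apply: cvg_harmonic].
apply: (squeeze_cvgr _ lower_cvg (cvg_cst _)); near=> n.
have n0 : (0 < n)%N by near: n; exists 1%N.
have nR : 0 < n%:R :> R by rewrite ltr0n.
have le_upper : 7%:R * (coex n J4)%:R <= 4%:R * n%:R :> R.
  by rewrite -!natrM ler_nat coex_J4_le.
(* Here 24 is 4 times the largest remainder 6 modulo 7. *)
have le_lower : 4%:R * n%:R <= 7%:R * (coex n J4)%:R + 24%:R :> R.
  rewrite -!natrM -natrD ler_nat; have := coex_J4_ge n.
  by have := divn_eq n 7; have := ltn_pmod n (isT : (0 < 7)%N); lia.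
rewrite /coex_density /harmonic; apply/andP; split; last first.
  by rewrite ler_pdivrMr // mulrAC ler_pdivlMr //; lra.
rewrite ler_pdivlMr // -subr_ge0.
(* The numerator is arranged as a sum of nonnegative terms. *)
have -> : (coex n J4)%:R - (4%:R / 7%:R - 8%:R * n.+1%:R^-1) * n%:R
  = ((7%:R * (coex n J4)%:R + 24%:R - 4%:R * n%:R) * n.+1%:R
     + 32%:R * (n%:R - 1) + 8%:R) / (7%:R * n.+1%:R) :> R.
  by rewrite -natr1; field; rewrite nat1r pnatr_eq0.
rewrite divr_ge0 // addr_ge0 // addr_ge0 ?mulr_ge0 // subr_ge0 ?ler1n //.
Unshelve. all: by end_near.
Qed.
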